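(* Let $m\ge1$, let $\alpha_1,\dots,\alpha_m\in[0,\pi/2)$, and let $X_j\in\mathbb{M}^s_{n,\alpha_j}$ for $j=1,2,\dots,m$. Then $$\omega\left(\prod_{j=1}^m X_j\right)\le\prod_{j=1}^m\sec(\alpha_j)\,\omega(X_j).$$
   Context: $\mathbb{M}_n$ is the algebra of all $n\times n$ complex matrices; $\prod_{j=1}^m X_j=X_1X_2\cdots X_m$. The numerical range of $X\in\mathbb{M}_n$ is $W(X)=\{\langle Xx,x\rangle : x\in\mathbb{C}^n,\ \|x\|=1\}$, with the standard inner product and Euclidean norm on $\mathbb{C}^n$, and the numerical radius is $\omega(X)=\sup\{|z| : z\in W(X)\}$. For $\alpha\in[0,\pi/2)$ let $S_\alpha=\{z\in\mathbb{C} : \operatorname{Re}(z)>0,\ |\operatorname{Im}(z)|\le\tan(\alpha)\operatorname{Re}(z)\}$, and let $\mathbb{M}^s_{n,\alpha}$ be the class of all $X\in\mathbb{M}_n$ such that $W(zX)\subset S_\alpha$ for some $z\in\mathbb{C}$ with $|z|=1$. *)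

(* Defs.v *)
From HB Require Import structures.
From mathcomp Require Import all_boot all_order all_algebra.
From mathcomp Require Import complex.
From mathcomp Require Import all_classical all_reals all_analysis.

Set Implicit Arguments.
Unset Strict Implicit.
Unset Printing Implicit Defensive.

Import Order.TTheory GRing.Theory Num.Theory.

Local Open Scope classical_set_scope.
Local Open Scope ring_scope.
Local Open Scope complex_scope.

(* [dotmx] acts on row vectors, is linear in its first argument and
   conjugate-linear in its second. *)
Definition cdot (R : realType) (n : nat) (u v : 'cV[R[i]]_n) : R[i] :=
  dotmx u^T v^T.

Definition cnorm (R : realType) (n : nat) (x : 'cV[R[i]]_n) : R[i] :=
  sqrtC (cdot x x).

Definition numrange (R : realType) (n : nat) (X : 'M[R[i]]_n) : set R[i] :=
  [set cdot (X *m x) x | x in [set x : 'cV[R[i]]_n | cnorm x = 1]].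

(* The library's modulus [`|z|] takes values in [R[i]] (with zero imaginary
   part), hence the real part. *)
Definition numradius (R : realType) (n : nat) (X : 'M[R[i]]_n) : R :=
  sup [set complex.Re `|z| | z in numrange X].

Definition sector (R : realType) (alpha : R) : set R[i] :=
  [set z | 0 < complex.Re z /\ `|complex.Im z| <= tan alpha * complex.Re z].

Definition sectorial (R : realType) (n : nat) (alpha : R) : set 'M[R[i]]_n :=
  [set X | exists2 z : R[i], `|z| = 1 & numrange (z *: X) `<=` sector alpha].

Definition sec (R : realType) (x : R) : R := (cos x)^-1.

(* Main.v *)
Require Import Defs.
From HB Require Import structures.
From mathcomp Require Import all_boot all_order all_algebra.
From mathcomp Require Import complex.
From mathcomp Require Import all_classical all_reals all_analysis.
From mathcomp Require Import ring lra.

Import Order.TTheory GRing.Theory Num.Theory.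

Local Open Scope classical_set_scope.
Local Open Scope ring_scope.
Local Open Scope complex_scope.

(* A sectorial matrix satisfies [||X|| <= sec(alpha) omega(X)]: rotate it so that
   [X = H + iT] with [|<Tx,x>| <= tan(alpha) <Hx,x>].  The forms
   [sin(alpha) H +- cos(alpha) T] are then positive semidefinite, [X] is a
   combination of them with coefficients of modulus [1 / (2 sin(alpha) cos(alpha))],
   and [2 |<Px,y>| <= <Px,x> + <Py,y>] for each of them adds up to
   [2 cos(alpha) |<Xx,y>| <= <Hx,x> + <Hy,y> <= omega(X) (||x||^2 + ||y||^2)].
   The theorem follows from [omega(A) <= ||A||] and submultiplicativity of the
   operator norm. *)

Section InnerProduct.
Context {R : realType} {n : nat}.
Implicit Types (x y u v : 'cV[R[i]]_n) (A X : 'M[R[i]]_n) (a z : R[i]).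

(** * Sesquilinearity of the inner product *)

Lemma ReD a z : complex.Re (a + z) = complex.Re a + complex.Re z.
Proof. by case: a z => [? ?] [? ?]. Qed.

Lemma conjcD a z : (a + z)^*%C = a^*%C + z^*%C.
Proof. by case: a z => [? ?] [? ?]; congr (_ +i* _); rewrite opprD. Qed.

Lemma cdotE u v : cdot u v = \sum_i u i 0 * (v i 0)^*%C.
Proof.
rewrite /cdot dotmxE mxE; apply: eq_bigr => i _.
by rewrite !mxE.
Qed.

Lemma cdotDl u v y : cdot (u + v) y = cdot u y + cdot v y.
Proof.
rewrite !cdotE -big_split /=; apply: eq_bigr => i _.
by rewrite mxE mulrDl.
Qed.

Lemma cdotC u v : cdot v u = (cdot u v)^*%C.
Proof.
rewrite !cdotE rmorph_sum /=; apply: eq_bigr => i _.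
by rewrite rmorphM /= conjcK mulrC.
Qed.

Lemma cdotZl a u v : cdot (a *: u) v = a * cdot u v.
Proof.
rewrite !cdotE mulr_sumr; apply: eq_bigr => i _.
by rewrite mxE mulrA.
Qed.

Lemma cdotDr u v y : cdot y (u + v) = cdot y u + cdot y v.
Proof. by rewrite cdotC cdotDl conjcD (cdotC u y) (cdotC v y). Qed.

Lemma cdotZr a u v : cdot u (a *: v) = a^*%C * cdot u v.
Proof. by rewrite cdotC cdotZl rmorphM /= -cdotC. Qed.

Lemma cdot_mulmxZl a A u v : cdot (a *: A *m u) v = a * cdot (A *m u) v.
Proof. by rewrite -scalemxAl cdotZl. Qed.

Lemma cdot_mulmxZr a A u v : cdot (A *m (a *: u)) v = a * cdot (A *m u) v.
Proof. by rewrite -scalemxAr cdotZl. Qed.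

(** * Real-valued squared norms and unit vectors *)

Definition sqnorm x : R := complex.Re (cdot x x).

Lemma cdotxx x : cdot x x = (sqnorm x)%:C.
Proof.
have /(congr1 (@complex.Im R)) := cdotC x x.
rewrite /sqnorm; case: (cdot x x) => a b /= e.
by apply/eqP; rewrite eq_complex /= eqxx /=; apply/eqP; lra.
Qed.

Definition sqmod z : R := complex.Re z ^+ 2 + complex.Im z ^+ 2.

Lemma sqmod_ge0 z : 0 <= sqmod z.
Proof. by rewrite addr_ge0 ?sqr_ge0. Qed.

Lemma sqmod_norm1 z : `|z| = 1 -> sqmod z = 1.
Proof. by move=> z1; apply: complexI; rewrite add_Re2_Im2 z1 expr1n. Qed.

Lemma sqnormE x : sqnorm x = \sum_i sqmod (x i 0).
Proof.
rewrite /sqnorm cdotE; elim/big_rec2: _ => // i a b _ <-.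
by rewrite ReD; congr (_ + _); rewrite /sqmod; case: (x i 0) => p q /=; ring.
Qed.

Lemma sqnorm_ge0 x : 0 <= sqnorm x.
Proof. by rewrite sqnormE sumr_ge0// => i _; exact: sqmod_ge0. Qed.

Lemma sqnormZ a x : sqnorm (a *: x) = sqmod a * sqnorm x.
Proof.
rewrite /sqnorm cdotZl cdotZr cdotxx /sqmod.
by case: a => p q /=; ring.
Qed.

Lemma cnorm1_sqnorm x : cnorm x = 1 <-> sqnorm x = 1.
Proof.
rewrite /cnorm cdotxx; split => [e|->].
  by have := sqrtCK (sqnorm x)%:C; rewrite e expr1n => /(congr1 (@complex.Re R)).
by rewrite sqrtC1.
Qed.

Lemma sqnorm_eq0 x : sqnorm x = 0 -> x = 0.
Proof.
rewrite sqnormE => /eqP; rewrite psumr_eq0 => [/allP x0|i _]; last exact: sqmod_ge0.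
apply/matrixP => i j; rewrite ord1 mxE.
have /= := x0 i (mem_index_enum _).
rewrite paddr_eq0 ?sqr_ge0// !sqrf_eq0.
by case: (x i 0) => p q /= /andP[/eqP -> /eqP ->].
Qed.

(** Reduces statements about quadratic forms to unit vectors, the only ones that the numerical range
    sees. *)
Lemma polar x : (0 < n)%N ->
  exists2 r : R, 0 <= r & exists2 w, cnorm w = 1 & x = r%:C *: w.
Proof.
move=> n0; have [/sqnorm_eq0 ->|nx] := eqVneq (sqnorm x) 0.
  (* The zero vector has no direction of its own; any basis vector serves. *)
  exists 0 => //; exists (delta_mx (Ordinal n0) 0); last by rewrite scale0r.
  apply/cnorm1_sqnorm; rewrite sqnormE (bigD1 (Ordinal n0)) //= big1 ?addr0.
    by rewrite mxE !eqxx /sqmod /= expr1n expr0n addr0.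
  by move=> i /negbTE ni; rewrite mxE ni /sqmod /= expr0n addr0.
have s0 : 0 < Num.sqrt (sqnorm x) by rewrite sqrtr_gt0 lt_def nx sqnorm_ge0.
have s0' := lt0r_neq0 s0.
exists (Num.sqrt (sqnorm x)); first exact: ltW.
exists ((Num.sqrt (sqnorm x))^-1%:C *: x); last first.
  by rewrite scalerA -rmorphM /= divff// scale1r.
apply/cnorm1_sqnorm; rewrite sqnormZ /sqmod /= expr0n addr0 exprVn.
by rewrite sqr_sqrtr ?sqnorm_ge0// mulVf.
Qed.

(** * Polarized inequalities for accretive matrices *)

(** Expand the form at [x - y], where it is nonnegative. *)
Lemma accretive_polar A : (forall x, 0 <= complex.Re (cdot (A *m x) x)) ->
  forall x y, complex.Re (cdot (A *m x) y) + complex.Re (cdot (A *m y) x) <=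
    complex.Re (cdot (A *m x) x) + complex.Re (cdot (A *m y) y).
Proof.
move=> A0 x y; have := A0 (x + (-1) *: y).
rewrite mulmxDr -scalemxAr !(cdotDl, cdotDr, cdotZl, cdotZr) !ReD.
case: (cdot _ _) (cdot _ _) (cdot _ _) (cdot _ _) => [? ?] [? ?] [? ?] [? ?] /=.
lra.
Qed.

(** This is [accretive_polar] for [a *: A] at [x] and [b *: y]. The scalars are kept outside the
    inner products, so that a suitable [b] can weight the two cross terms differently. *)
Lemma accretive_rotate A a b x y :
  (forall u, 0 <= complex.Re (a * cdot (A *m u) u)) ->
  complex.Re (a * (b^*%C * cdot (A *m x) y)) + complex.Re (a * (b * cdot (A *m y) x)) <=
  complex.Re (a * cdot (A *m x) x) +
    complex.Re (a * (b * (b^*%C * cdot (A *m y) y))).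
Proof.
move=> aA0.
have A0 u : 0 <= complex.Re (cdot (a *: A *m u) u) by rewrite cdot_mulmxZl.
have := accretive_polar _ A0 x (b *: y).
rewrite (cdot_mulmxZl a A x x) (cdot_mulmxZl a A x (b *: y)) (cdotZr b (A *m x) y).
rewrite (cdot_mulmxZl a A (b *: y)) (cdot_mulmxZr b A y).
by rewrite (cdot_mulmxZl a A (b *: y)) (cdot_mulmxZr b A y) cdotZr.
Qed.

(** The identity matrix is accretive, and its two cross terms are conjugate, hence have equal real
    parts. *)
Lemma Re_cdot_le x y : 2 * complex.Re (cdot x y) <= sqnorm x + sqnorm y.
Proof.
have I0 u : 0 <= complex.Re (cdot (1%:M *m u) u) by rewrite mul1mx sqnorm_ge0.
have e : complex.Re (cdot x y) = complex.Re (cdot y x).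
  by rewrite (cdotC y x); case: (cdot y x).
have := accretive_polar 1%:M I0 x y; rewrite !mul1mx.
by rewrite mulr_natl mulr2n [X in _ -> _ + X <= _]e.
Qed.

(* With [A = H + iT] and [u = c + is], both [s H + c T] and [s H - c T] are
   nonnegative: they are the Hermitian parts of [- i u A] and [i u^* A].
   Moreover [u (s H + c T) + u^* (s H - c T) = 2 s c A].  For [s = 0] this
   degenerates, but then [T = 0]. *)
Lemma sector_form_le (c s : R) A : c ^+ 2 + s ^+ 2 = 1 -> 0 < c -> 0 <= s ->
  (forall x, 0 <= complex.Re (cdot (A *m x) x)) ->
  (forall x, c * `|complex.Im (cdot (A *m x) x)| <= s * complex.Re (cdot (A *m x) x)) ->
  forall x y, 2 * c * complex.Re (cdot (A *m x) y) <=
    complex.Re (cdot (A *m x) x) + complex.Re (cdot (A *m y) y).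
Proof.
move=> cs1 c0 s0 A0 As x y.
have Asl v : c * complex.Im (cdot (A *m v) v) <= s * complex.Re (cdot (A *m v) v).
  by apply: le_trans (As v); rewrite ler_pM2l// ler_norm.
have Asr v : - (c * complex.Im (cdot (A *m v) v)) <= s * complex.Re (cdot (A *m v) v).
  by apply: le_trans (As v); rewrite -mulrN ler_pM2l// -normrN ler_norm.
have P v : 0 <= complex.Re ((s -i* c) * cdot (A *m v) v).
  by move: (Asr v); case: (cdot _ _) => p q /=; lra.
have Q v : 0 <= complex.Re ((s +i* c) * cdot (A *m v) v).
  by move: (Asl v); case: (cdot _ _) => p q /=; lra.
have [s00|sn0] := eqVneq s 0.
  have c1 : c = 1.
    apply/eqP; move: cs1; rewrite s00 expr0n addr0 => /eqP.
    by rewrite sqrp_eq1// ltW.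
  (* Since [T = 0], the two rotations by ['i] give [Re <Ax,y> = Re <Ay,x>], and [accretive_polar]
     then bounds twice this value. *)
  have := accretive_rotate A _ 'i x y P; have := accretive_rotate A _ 'i x y Q.
  have := accretive_polar _ A0 x y.
  have := Asl x; have := Asr x; have := Asl y; have := Asr y.
  rewrite s00 c1.
  case: (cdot (A *m x) y) (cdot (A *m y) x) (cdot (A *m x) x) (cdot (A *m y) y)
    => [? ?] [? ?] [? ?] [? ?] /=.
  lra.
have sp : 0 < s by rewrite lt_def sn0.
(* With these phases [<Ay,x>] gets the coefficients [-i] and [i], which cancel in the sum, while
   those of [<Ax,y>] are conjugate with real part [2 s c]. *)
have := accretive_rotate A _ (c -i* s) x y P.
have := accretive_rotate A _ (c +i* s) x y Q.
case: (cdot (A *m x) y) (cdot (A *m y) x) (cdot (A *m x) x) (cdot (A *m y) y)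
    => [p1 p2] [q1 q2] [h1 t1] [h2 t2] /= e1 e2.
rewrite -(ler_pM2l sp).
suff : s * (2 * c * p1) <= s * (h1 + (c ^+ 2 + s ^+ 2) * h2) by rewrite cs1 mul1r.
lra.
Qed.

(** * Moduli, phases and the numerical radius *)

Lemma normr_ReC z : `|z| = (complex.Re `|z|)%:C.
Proof. by rewrite normc_def. Qed.

Lemma Re_norm_le z : `|complex.Re z| <= complex.Re `|z|.
Proof.
rewrite normc_def /= -sqrtr_sqr ler_sqrt ?addr_ge0 ?sqr_ge0//.
by rewrite lerDl sqr_ge0.
Qed.

Lemma Re_normM a z : `|a| = 1 -> complex.Re `|a * z| = complex.Re `|z|.
Proof. by move=> a1; rewrite normrM a1 mul1r. Qed.

(** The phase is the conjugate of [z] divided by its modulus. It lets bounds on real parts control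
    moduli. *)
Lemma exists_phase z : exists2 a, sqmod a = 1 & complex.Re `|z| = complex.Re (a * z).
Proof.
have [->|z0] := eqVneq z 0.
  by exists 1; rewrite ?normr0 ?mulr0// /sqmod /= expr1n expr0n addr0.
have nz : Num.sqrt (complex.Re z ^+ 2 + complex.Im z ^+ 2) != 0.
  by apply: contra z0 => /eqP e; rewrite -normr_eq0 normc_def e.
have sz := sqr_sqrtr (sqmod_ge0 z).
exists ((Num.sqrt (sqmod z))^-1%:C * z^*%C).
  rewrite /sqmod in nz sz *; move: sz nz; case: z {z0} => p q /=.
  move: (Num.sqrt _) => r sz nz.
  have -> : (r^-1 * p - 0 * - q) ^+ 2 + (r^-1 * - q + 0 * p) ^+ 2 =
      (p ^+ 2 + q ^+ 2) / r ^+ 2.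
    by field.
  by rewrite -sz divff// sqrf_eq0.
rewrite normc_def /sqmod in nz sz *; move: sz nz; case: z {z0} => p q /=.
move: (Num.sqrt _) => r sz nz.
have -> : (r^-1 * p - 0 * - q) * p - (r^-1 * - q + 0 * p) * q = (p ^+ 2 + q ^+ 2) / r.
  by field.
by rewrite -sz expr2 mulfK.
Qed.

(** Coordinates of a unit vector have modulus at most 1, so the moduli of the entries of [X] sum to
    a bound. This makes [sup] a genuine upper bound rather than a default value. *)
Lemma numrange_bounded X : has_ubound [set complex.Re `|z| | z in numrange X].
Proof.
exists (\sum_i \sum_j complex.Re `|X i j|) => _ [_ [x /= x1 <-] <-].
have xi i : `|x i 0| <= 1.
  rewrite -(expr_le1 (n := 2))// -add_Re2_Im2 -[1]/(1%:C) lecR.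
  have /cnorm1_sqnorm <- := x1.
  by rewrite sqnormE (bigD1 i) //= lerDl sumr_ge0// => j _; exact: sqmod_ge0.
rewrite -lecR -normr_ReC cdotE rmorph_sum /=.
apply: le_trans (ler_norm_sum _ _ _) _; apply: ler_sum => i _.
rewrite normrM rmorph_sum /= mxE.
have -> : `|(x i 0)^*%C| = `|x i 0|.
  by rewrite !normc_def; case: (x i 0) => p q /=; rewrite sqrrN.
apply: le_trans (ler_piMr _ (xi i)) _ => //.
apply: le_trans (ler_norm_sum _ _ _) _; apply: ler_sum => j _.
by rewrite -normr_ReC normrM ler_piMr.
Qed.

Lemma numradius_ge X x : cnorm x = 1 -> complex.Re `|cdot (X *m x) x| <= numradius X.
Proof.
move=> x1; apply: ub_le_sup; first exact: numrange_bounded.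
by exists (cdot (X *m x) x) => //; exists x.
Qed.

(** * Sectorial matrices, operator norm bounds and products *)

Lemma exists_unit_vector : (0 < n)%N -> exists x, cnorm x = 1.
Proof. by move=> /(polar 0)[_ _ [w w1 _]]; exists w. Qed.

Lemma cdot_mulmx_polar A (r : R) u :
  cdot (A *m (r%:C *: u)) (r%:C *: u) = (r ^+ 2)%:C * cdot (A *m u) u.
Proof.
by rewrite cdot_mulmxZr cdotZr mulrA expr2 rmorphM /= oppr0.
Qed.

(** A value of the form in the sector has positive real part, and rotation preserves its modulus.
    Strict positivity allows dividing by the norm bound later. *)
Lemma sectorial_numradius_gt0 X (alpha : R) : (0 < n)%N ->
  sectorial alpha X -> 0 < numradius X.
Proof.
move=> n0 [z z1 Xz]; have [x x1] := exists_unit_vector n0.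
apply: lt_le_trans (numradius_ge X x x1).
have [] : sector alpha (cdot (z *: X *m x) x) by apply: Xz; exists x.
rewrite cdot_mulmxZl => h _; rewrite -(Re_normM z)//.
by apply: lt_le_trans h _; apply: le_trans (ler_norm _) (Re_norm_le _).
Qed.

Lemma sectorial_polar_le X (alpha : R) : (0 < n)%N -> 0 <= alpha < pi / 2 ->
  sectorial alpha X -> forall x y,
  2 * complex.Re (cdot (X *m x) y) <=
    sec alpha * numradius X * (sqnorm x + sqnorm y).
Proof.
move=> n0 /andP[a0 a1] [z z1 Xz] x y.
have c0 : 0 < cos alpha.
  by rewrite cos_gt0_pihalf// a1 (lt_le_trans _ a0)// oppr_lt0 divr_gt0 ?pi_gt0.
have s0 : 0 <= sin alpha.
  have [->|an0] := eqVneq alpha 0; first by rewrite sin0.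
  by rewrite ltW// sin_gt0_pihalf// a1 lt_def an0 a0.
pose A := z *: X.
(* The sector condition concerns unit vectors only; homogeneity of degree 2 extends this bound and
   the next two to all vectors. *)
have A0 x' : 0 <= complex.Re (cdot (A *m x') x').
  have [r r0 [w w1 ->]] := polar x' n0.
  have [] : sector alpha (cdot (A *m w) w) by apply: Xz; exists w.
  rewrite cdot_mulmx_polar; case: (cdot _ _) => p q /= p0 _.
  by rewrite mul0r subr0 mulr_ge0 ?sqr_ge0// ltW.
have As x' : cos alpha * `|complex.Im (cdot (A *m x') x')| <=
    sin alpha * complex.Re (cdot (A *m x') x').
  have [r r0 [w w1 ->]] := polar x' n0.
  have [] : sector alpha (cdot (A *m w) w) by apply: Xz; exists w.
  rewrite cdot_mulmx_polar; case: (cdot _ _) => p q /= _.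
  rewrite !mul0r subr0 addr0 normrM (ger0_norm (sqr_ge0 r)) /tan => h.
  by rewrite mulrCA [leRHS]mulrCA ler_wpM2l ?sqr_ge0// mulrC -ler_pdivlMr// mulrAC.
have Aw x' : complex.Re (cdot (A *m x') x') <= numradius X * sqnorm x'.
  have [r r0 [w w1 ->]] := polar x' n0.
  rewrite cdot_mulmx_polar sqnormZ.
  have /cnorm1_sqnorm -> := w1; rewrite mulr1.
  have := numradius_ge X w w1; rewrite -(Re_normM z)// -cdot_mulmxZl -/A.
  move=> /(le_trans (le_trans (ler_norm _) (Re_norm_le _))).
  case: (cdot _ _) => p q /=; rewrite /sqmod /= expr0n mul0r subr0 addr0 => h.
  by rewrite mulrC ler_wpM2r ?sqr_ge0.
have zz : z^*%C * z = 1.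
  have := sqmod_norm1 z z1; rewrite /sqmod; case: (z) => p q /= e.
  by apply/eqP; rewrite eq_complex /=; apply/andP; split; apply/eqP; lra.
(* Testing against [z *: y] cancels the rotation: [<zXx, zy> = <Xx,y>] because [z] has modulus 1. *)
have := sector_form_le _ _ A (cos2Dsin2 alpha) c0 s0 A0 As x (z *: y).
rewrite (cdot_mulmxZl z X x) cdotZr (mulrA z) (mulrC z) zz mul1r.
have Ay := Aw (z *: y); rewrite sqnormZ sqmod_norm1// mul1r in Ay.
have combine (c w p h k a b : R) : 0 < c -> h <= w * a -> k <= w * b ->
    2 * c * p <= h + k -> 2 * p <= c^-1 * w * (a + b).
  move=> c_gt0 hw kw pk; rewrite -mulrA ler_pdivlMl// mulrA [c * 2]mulrC.
  by rewrite (le_trans pk)// mulrDr lerD.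
exact: combine c0 (Aw x) Ay.
Qed.

(* Take [y] proportional to [A x] in the hypothesis. *)
Lemma polar_le_sqnorm A (K : R) : 0 < K ->
  (forall x y, 2 * complex.Re (cdot (A *m x) y) <= K * (sqnorm x + sqnorm y)) ->
  forall x, sqnorm (A *m x) <= K ^+ 2 * sqnorm x.
Proof.
(* With [y = Ax / K] the left side is [2 ||Ax||^2 / K], and half of it absorbs the term
   [K ||y||^2]. *)
move=> K0 AK x; have := AK x (K^-1%:C *: (A *m x)).
rewrite cdotZr cdotxx sqnormZ /sqmod /= expr0n addr0.
rewrite oppr0 mul0r subr0 => h.
have e : K * K^-1 = 1 by rewrite divff// gt_eqF.
have := ler_wpM2l (ltW K0) h.
move: (sqnorm x) (sqnorm _) => a b.
have -> : K * (2 * (K^-1 * b)) = 2 * (K * K^-1) * b by ring.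
have -> : K * (K * (a + K^-1 ^+ 2 * b)) = K ^+ 2 * a + (K * K^-1) ^+ 2 * b by ring.
by clear AK h; rewrite e; lra.
Qed.

Lemma numradius_le A (K : R) : (0 < n)%N -> 0 < K ->
  (forall x, sqnorm (A *m x) <= K ^+ 2 * sqnorm x) -> numradius A <= K.
Proof.
move=> n0 K0 AK; apply: ge_sup.
  by have [x x1] := exists_unit_vector n0;
    exists (complex.Re `|cdot (A *m x) x|), (cdot (A *m x) x) => //; exists x.
move=> _ [_ [x x1 <-] <-].
have [a a1 ->] := exists_phase (cdot (A *m x) x).
(* Scaling [x] by [K] balances the two squares: both are at most [K ^+ 2], so
   [2 K |<Ax,x>| <= 2 K ^+ 2]. *)
have := Re_cdot_le (a *: (A *m x)) (K%:C *: x).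
rewrite (sqnormZ a) (sqnormZ K%:C) a1 (cdotZl a) (cdotZr K%:C).
have := AK x; rewrite ((cnorm1_sqnorm x).1 x1).
have -> d : complex.Re (a * (K%:C^*%C * d)) = K * complex.Re (a * d).
  by case: a d {a1} => [p q] [s t] /=; ring.
clear -K0; move: (sqnorm _) (complex.Re _) => N p.
rewrite /sqmod /= => e1 e2; rewrite -(ler_pM2l K0); lra.
Qed.

Lemma sqnorm_prod_le m (X : 'I_m -> 'M[R[i]]_n) (K : 'I_m -> R) :
  (forall j x, sqnorm (X j *m x) <= K j ^+ 2 * sqnorm x) ->
  forall x, sqnorm ((\prod_(j < m) X j) *m x) <= (\prod_(j < m) K j) ^+ 2 * sqnorm x.
Proof.
move=> XK; elim/big_rec2: _ => [x|j k A _ IH x]; first by rewrite mul1mx expr1n mul1r.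
rewrite -mulmxA; apply: le_trans (XK _ _) _.
by rewrite exprMn -[leRHS]mulrA ler_wpM2l ?sqr_ge0.
Qed.

End InnerProduct.

Theorem theorem2p2 (R : realType) (n m : nat) (alpha : 'I_m -> R)
    (X : 'I_m -> 'M[R[i]]_n)
    (n_gt0 : (0 < n)%N) (m_gt0 : (0 < m)%N)
    (alpha_range : forall j, 0 <= alpha j < pi / 2)
    (X_sectorial : forall j, sectorial (alpha j) (X j)) :
  numradius (\prod_(j < m) X j) <=
  \prod_(j < m) (sec (alpha j) * numradius (X j)).
Proof.
have K0 j : 0 < sec (alpha j) * numradius (X j).
  have /andP[a0 a1] := alpha_range j.
  rewrite mulr_gt0 ?invr_gt0 ?cos_gt0_pihalf ?a1 ?andbT//.
    by rewrite (lt_le_trans _ a0)// oppr_lt0 divr_gt0 ?pi_gt0.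
  exact: sectorial_numradius_gt0 (X_sectorial j).
apply: numradius_le => //; first by rewrite prodr_gt0.
apply: sqnorm_prod_le => j; apply: polar_le_sqnorm => //.
exact: sectorial_polar_le.
Qed.
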